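(* Let $n \geq 3$ be an integer. Then the number of equivalence classes of $P_n$ under $\equiv_E$ is \[ |P_n/\!\equiv_E| = \frac{1}{2}\left[(n-1)! + \begin{cases} (n-2)!!, & \text{if $n$ is even;}\\ 0, & \text{if $n$ is odd.}\end{cases}\right] \]
   Context: Identify the vertices of the complete graph $K_n$ with $n$ regularly spaced points on a circle, labelled $0,1,\dots,n-1$ in cyclic order (the geometric realization); edges are drawn as line segments. $P_n$ denotes the set of subgraphs of $K_n$ induced by Hamiltonian paths: the subgraph has all $n$ vertices and exactly the edges traversed by the path. Two subgraphs $G_1,G_2$ are equivalent, $G_1 \equiv_E G_2$, if one is obtained from the other by a rotation (not a reflection) of the regular $n$-gon of vertices, i.e. by applying to the vertex labels a map $x \mapsto x + k \pmod n$. For a positive integer $m$, $m!!$ denotes the product of $m$ with all positive integers less than $m$ of the same parity as $m$. *)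

(* Defs.v *)
From mathcomp Require Import all_boot all_order all_algebra.

Set Implicit Arguments.
Unset Strict Implicit.
Unset Printing Implicit Defensive.

(** The vertices of K_n are the labels ['I_n], in cyclic order around the
    circle; a (labelled) graph on these points is a pair
    (vertex set, edge set), an edge being the set of its two endpoints. *)

Definition Kn (n : nat) : rel 'I_n := fun x y => x != y.

Definition graph (n : nat) : Type := ({set 'I_n} * {set {set 'I_n}})%type.

Definition hamiltonian_path (n : nat) (p : seq 'I_n) : bool :=
  [&& sorted (@Kn n) p, uniq p & [forall x, x \in p]].

(** [zip p (behead p)] lists the pairs of consecutive vertices of [p]. *)
Definition path_subgraph (n : nat) (p : seq 'I_n) : graph n :=
  ([set x in p],
   [set e in [seq [set xy.1; xy.2] | xy <- zip p (behead p)]]).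

(** A Hamiltonian path of K_n lists exactly n vertices, so ranging over
    [n.-tuple 'I_n] loses nothing. *)
Definition P (n : nat) : {set graph n} :=
  [set path_subgraph p | p : n.-tuple 'I_n & hamiltonian_path p].

Lemma rotv_subproof (n k : nat) (x : 'I_n) : (x + k) %% n < n.
Proof. by rewrite ltn_pmod // (leq_ltn_trans (leq0n x)). Qed.

Definition rotv (n k : nat) (x : 'I_n) : 'I_n := Ordinal (rotv_subproof k x).

Definition rotate_graph (n k : nat) (G : graph n) : graph n :=
  (rotv k @: G.1, [set rotv k @: e | e : {set 'I_n} in G.2]).

Definition equivE (n : nat) : rel (graph n) :=
  fun G1 G2 => [exists k : 'I_n, G2 == rotate_graph k G1].

Lemma rotvD (n j k : nat) (x : 'I_n) :
  rotv j (rotv k x) = rotv ((k + j) %% n) x.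
Proof. by apply: val_inj; rewrite /= modnDml modnDmr addnA. Qed.

Lemma rotv0 (n : nat) (x : 'I_n) : rotv 0 x = x.
Proof. by apply: val_inj; rewrite /= addn0 modn_small. Qed.

Lemma rotate_graphD (n j k : nat) (G : graph n) :
  rotate_graph j (rotate_graph k G) = rotate_graph ((k + j) %% n) G.
Proof.
rewrite /rotate_graph /=; congr pair; rewrite -imset_comp; apply: eq_imset => x.
  exact: rotvD.
by rewrite /= -imset_comp; apply: eq_imset => y; apply: rotvD.
Qed.

Lemma rotate_graph0 (n : nat) (G : graph n) : rotate_graph 0 G = G.
Proof.
have rE (A : {set 'I_n}) : rotv 0 @: A = A.
  by rewrite (eq_imset _ (@rotv0 n)) imset_id.
by case: G => V E; rewrite /rotate_graph /= rE (eq_imset _ rE) imset_id.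
Qed.

Lemma equivEP (n : nat) (G1 G2 : graph n) :
  reflect (exists k : 'I_n, G2 = rotate_graph k G1) (equivE G1 G2).
Proof. exact: 'exists_eqP. Qed.

Lemma equivE_equivalence (n : nat) : 0 < n -> equivalence_rel (@equivE n).
Proof.
move=> n_gt0.
have refl : reflexive (@equivE n).
  by move=> G; apply/equivEP; exists (Ordinal n_gt0); rewrite rotate_graph0.
have sym : symmetric (@equivE n).
  have h (G H : graph n) : equivE G H -> equivE H G.
    case/equivEP=> k ->; apply/equivEP.
    exists (Ordinal (ltn_pmod (n - k) n_gt0)).
    rewrite rotate_graphD /= modnDmr subnKC ?modnn ?rotate_graph0 //.
    exact: ltnW.
  by move=> G H; apply/idP/idP; apply: h.
have tr : transitive (@equivE n).
  move=> H G K /equivEP[k ->] /equivEP[j ->]; apply/equivEP.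
  by exists (Ordinal (ltn_pmod (k + j) n_gt0)); rewrite rotate_graphD.
by apply/equivalence_relP; split=> // G H GH; apply: (left_trans sym tr).
Qed.

Definition dfact (m : nat) : nat :=
  \prod_(1 <= i < m.+1 | odd i == odd m) i.

(* Main.v *)
(** A Hamiltonian path, traversed from either end, is determined by its edges
    up to reversal.  Up to rotation it may be taken to start at 0, which leaves
    (n-1)! sequences; two of them give equivalent subgraphs iff they coincide
    or are exchanged by the involution p |-> rev p - last p.  Hence twice the
    number of classes is (n-1)! plus the number of fixed points.  A fixed point
    has 2 * last p = n, so there is none for n odd; for n = 2h it has the form
    a ++ (rev a + h), where a starts at 0 and contains exactly one vertex of
    each antipodal pair {x, x + h}: this leaves (n-2)(n-4)...2 choices. *)

Require Import Defs.
From mathcomp Require Import all_boot all_order all_algebra.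

Set Implicit Arguments.
Unset Strict Implicit.
Unset Printing Implicit Defensive.

Import GRing.Theory.

(** * Counting the image of a map whose fibres have at most two elements *)

(** The fibre of [f] through [s] is [[set s; g s]]: two elements, neither fixed, or a single fixed
    one. Either way its size plus its number of fixed points is 2. *)
Lemma card_imset_pairs (T U : finType) (A : {set T}) (f : T -> U) (g : T -> T) :
    {in A, forall s, g s \in A} ->
    {in A &, forall s t, (f s == f t) = (t == s) || (t == g s)} ->
  2 * #|f @: A| = #|A| + #|[set s in A | g s == s]|.
Proof.
move=> gA fE.
rewrite mulnC -sum_nat_const -[#|A|]sum1_card (partition_big_imset f) /=.
rewrite -[#|[set s in A | _]|]sum1dep_card big_mkcondr /=.
rewrite [X in _ = _ + X](partition_big_imset f) /= -big_split /=.
apply: eq_bigr => _ /imsetP[s sA ->].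
rewrite sum1dep_card -big_mkcondr sum1dep_card /=.
have -> : [set t in A | f t == f s] = [set s; g s].
  apply/setP=> t; rewrite !inE; have [tA|tA] /= := boolP (t \in A).
    by rewrite eq_sym fE.
  by apply/esym/norP; split; apply: contraNneq tA => -> //; apply: gA.
(* [f] agrees on [s] and [g s], so [s] is [g s] or [g (g s)]; hence [g s] is not fixed unless [s]
   is. *)
have gg : g (g s) = g s -> g s = s.
  move=> e; have := fE _ _ sA (gA _ sA); rewrite eqxx orbT eq_sym fE ?gA //.
  by rewrite e orbb => /eqP ->.
rewrite cards2; have [e|ne] := eqVneq (g s) s.
  have -> : [set t | (t \in A) && (f t == f s) && (g t == t)] = [set s].
    apply/setP=> t; rewrite !inE; have [tA|tA] /= := boolP (t \in A); last first.
      by apply/esym; apply: contraNF tA => /eqP->.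
    rewrite eq_sym fE // e orbb; case: eqP => // ->; exact/eqP.
  by rewrite cards1.
have -> : [set t | (t \in A) && (f t == f s) && (g t == t)] = set0.
  apply/setP=> t; rewrite !inE; have [tA|//] /= := boolP (t \in A).
  rewrite eq_sym fE //; apply/negP=> /andP[/orP[]/eqP-> /eqP e].
    by rewrite e eqxx in ne.
  by rewrite gg ?eqxx in ne.
by rewrite cards0.
Qed.

(** * Recovering a path from its edges *)

Section EdgeSequence.
Variable T : finType.
Implicit Types (p q : seq T) (e : {set T}).

(** Convertible to the edge list in [path_subgraph], but over any finite type. *)
Definition edges p := [seq [set xy.1; xy.2] | xy <- zip p (behead p)].

Lemma edges_cons2 x y p : edges [:: x, y & p] = [set x; y] :: edges (y :: p).
Proof. by []. Qed.

Lemma edgesP p e :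
  reflect (exists p1 a b p2, p = p1 ++ [:: a, b & p2] /\ e = [set a; b])
          (e \in edges p).
Proof.
apply: (iffP idP); last first.
  case=> p1 [a [b [p2 [-> ->]]]]; elim: p1 => [|c p1 IH] /=.
    by rewrite edges_cons2 mem_head.
  by case: p1 IH => [|d p1] IH; rewrite /= edges_cons2 inE IH orbT.
elim: p => [//|x [//|y p] IH]; rewrite edges_cons2 inE => /predU1P[->|/IH].
  by exists [::], x, y, p.
by case=> p1 [a [b [p2 [-> ->]]]]; exists (x :: p1), a, b, p2.
Qed.

Lemma mem_edges p a b : [set a; b] \in edges p -> a \in p /\ b \in p.
Proof.
case/edgesP=> p1 [c [d [p2 [-> /setP E]]]].
have h z : z \in [set c; d] -> z \in p1 ++ [:: c, d & p2].
  by rewrite !inE mem_cat !inE => /orP[]->; rewrite !orbT.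
by split; apply: h; rewrite -E !inE eqxx ?orbT.
Qed.

Lemma edges_rev p : edges (rev p) =i edges p.
Proof.
have h q e : e \in edges q -> e \in edges (rev q).
  case/edgesP=> p1 [a [b [p2 [-> ->]]]]; apply/edgesP.
  exists (rev p2), b, a, (rev p1); rewrite rev_cat !rev_cons -!cats1 -!catA.
  by rewrite setUC.
by move=> e; apply/idP/idP => [/h|/h //]; rewrite revK.
Qed.

Lemma eq_edges_size x y p q : edges [:: x, y & p] =i edges q -> 1 < size q.
Proof.
by move=> /(_ [set x; y]); rewrite edges_cons2 mem_head; case: q => [|?[]].
Qed.

Lemma set2_eql (a b c : T) : [set a; b] = [set a; c] -> b = c.
Proof.
move=> /setP E; move: (E b) (E c); rewrite !inE !eqxx !orbT.
by move=> /esym/orP[]/eqP-> // /orP[]/eqP.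
Qed.

(** The vertex [x] does not recur, so only the first edge contains it. *)
Lemma head_edge x y p b :
  uniq [:: x, y & p] -> [set x; b] \in edges [:: x, y & p] -> b = y.
Proof.
case/andP=> xp _; rewrite edges_cons2 inE => /predU1P[/set2_eql //|].
by case/mem_edges=> xin; rewrite xin in xp.
Qed.

(** The only edge at [x] gives the second vertex; removing it leaves the same claim for the
    tails. *)
Lemma eq_edges_head x p q : uniq (x :: p) -> uniq (x :: q) ->
  edges (x :: p) =i edges (x :: q) -> p = q.
Proof.
elim: p q x => [|y p IH] [|z q] x //.
- by move=> _ _ /(_ [set x; z]); rewrite edges_cons2 mem_head.
- by move=> _ _ /(_ [set x; y]); rewrite edges_cons2 mem_head.
move=> Up Uq E.
have yz : y = z.
  by apply: (head_edge Uq); rewrite -E edges_cons2 mem_head.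
rewrite -{z}yz in Uq E *; congr cons; case/andP: (Up) (Uq) => xp Up' /andP[xq Uq'].
apply: (IH _ y) => // e; have := E e; rewrite !edges_cons2 !inE.
(* Neither tail contains [x], so this edge belongs to neither. *)
have [-> _|//] := eqVneq e [set x; y].
by apply/idP/idP => /mem_edges[xin]; [rewrite xin in xp | rewrite xin in xq].
Qed.

(* The endpoints of a path are its vertices of degree one. *)
Lemma eq_edges p q : uniq p -> uniq q -> 1 < size p ->
  edges p =i edges q -> q = p \/ q = rev p.
Proof.
case: p => [|x[|y p]] // Up Uq _ E; have := eq_edges_size E.
case: q Uq E => [|u[|v q]] // Uq E _.
have : [set u; v] \in edges [:: x, y & p] by rewrite E edges_cons2 mem_head.
case/mem_edges; set p' := [:: x, y & p] in Up E *.
have hd w r : uniq (u :: r) -> w = u :: r -> edges w =i edges [:: u, v & q] ->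
    [:: u, v & q] = w.
  by move=> Ur -> /(eq_edges_head Ur Uq) ->.
(* The start [u] of the second path is the first vertex of [p'], its last one (then reverse), or an
   interior one. *)
case/splitPr E': {1}p' / => [p1 p2] _.
case/lastP: p1 E' => [/= E'|p1 a].
  by left; apply: (hd _ p2) => //; rewrite -E'.
case: p2 => [|b p2] E'.
  right; rewrite cats1 in E'; have rE : rev p' = u :: rev (rcons p1 a).
    by rewrite E' !rev_rcons.
  by apply: (hd _ _ _ rE) => [|e]; rewrite -?rE ?rev_uniq // edges_rev E.
(* An interior [u] has neighbours [a] and [b]; both equal [v], its only neighbour on the second
   path, so [v] repeats in [p']. *)
exfalso; move: E' Up; rewrite cat_rcons => E' Up.
have av : a = v.
  apply: (head_edge Uq); rewrite -E setUC; apply/edgesP.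
  by exists p1, a, u, (b :: p2).
have bv : b = v.
  apply: (head_edge Uq); rewrite -E; apply/edgesP.
  by exists (rcons p1 a), u, b, p2; rewrite cat_rcons.
move: Up; rewrite E' av bv cat_uniq /= !inE eqxx !orbT.
by rewrite !andbF.
Qed.

End EdgeSequence.

(** * Sequences free of antipodal pairs *)

Section Antipodal.
Variables (T : finType) (sigma : T -> T).
Hypotheses (sigmaK : involutive sigma) (sigma_neq : forall x, sigma x != x).

(** A single uniqueness test: the entries are distinct and none is the [sigma]-image of an entry. *)
Definition antipode_free (s : seq T) := uniq (s ++ map sigma s).

Lemma antipode_free_cons x s : antipode_free (x :: s) =
  antipode_free s && (x \notin s ++ map sigma s).
Proof.
have sx : (sigma x \in map sigma s) = (x \in s).
  exact: (mem_map (inv_inj sigmaK)).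
have xs : (x \in map sigma s) = (sigma x \in s).
  by rewrite -{1}(sigmaK x) (mem_map (inv_inj sigmaK)).
rewrite /antipode_free /= -[sigma x :: _]cat1s uniq_catCA /= !mem_cat !inE.
rewrite eq_sym (negPf (sigma_neq x)) /= sx xs orbC.
by case: (_ || _); rewrite /= ?andbT ?andbF.
Qed.

(** The excluded values are the entries of [s] and their antipodes, all distinct. *)
Lemma card_antipode_free_cons s : antipode_free s ->
  #|[pred x | antipode_free (x :: s)]| = #|T| - 2 * size s.
Proof.
move=> gs; have -> : 2 * size s = #|s ++ map sigma s|.
  by rewrite (card_uniqP gs) size_cat size_map mul2n addnn.
rewrite -[#|T|](cardC (mem (s ++ map sigma s))) addKn; apply: eq_card => x.
by rewrite !inE antipode_free_cons gs.
Qed.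

Lemma antipode_free_catrev t s : antipode_free (catrev t s) -> antipode_free s.
Proof. by elim: t s => [//|x t IH] s /= /IH; rewrite antipode_free_cons => /andP[]. Qed.

(** [catrev] pushes the entries of [t] onto [s] in order, so entry [i] has to avoid [size s + i]
    antipodal pairs. *)
Lemma card_antipode_free_tuples j s : antipode_free s ->
  #|[set t : j.-tuple T | antipode_free (catrev t s)]|
    = \prod_(i < j) (#|T| - 2 * (size s + i)).
Proof.
elim: j s => [|j IH] s gs.
  rewrite big_ord0; apply/eqP/cards1P; exists [tuple].
  by apply/setP=> t; rewrite !inE tuple0 eqxx.
rewrite big_ord_recl addn0 -(card_antipode_free_cons gs) -sum_nat_const.
rewrite -sum1_card (partition_big (fun t => thead t)
  [pred x | antipode_free (x :: s)]) /=; last first.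
  move=> t; case/tupleP: t => x t; rewrite inE /= theadE.
  exact: antipode_free_catrev.
apply: eq_bigr => x gx; rewrite sum1dep_card.
transitivity #|[set t : j.-tuple T | antipode_free (catrev t (x :: s))]|.
  rewrite -(card_imset _ (f := fun t : j.-tuple T => [tuple of x :: t])); last first.
    by move=> t u [] /val_inj.
  apply: eq_card => t; apply/idP/imsetP => [|[u]]; rewrite !inE.
    case/tupleP: t => y t /= /andP[g]; rewrite theadE => /eqP e.
    by exists t; rewrite ?inE -e.
  by move=> g ->; rewrite theadE eqxx andbT.
rewrite IH //; apply: eq_bigr => i _; congr (_ - 2 * _).
by rewrite /= /bump leq0n addSnnS.
Qed.

End Antipodal.

(** * Path subgraphs under reversal and rotation *)

Section PathSubgraph.
Variable n : nat.
Implicit Types p q : seq 'I_n.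

Lemma path_subgraphE p : path_subgraph p = ([set x in p], [set e in edges p]).
Proof. by []. Qed.

Lemma path_subgraph_rev p : path_subgraph (rev p) = path_subgraph p.
Proof.
rewrite !path_subgraphE; congr pair; apply/setP=> x; rewrite !inE ?mem_rev //.
exact: edges_rev.
Qed.

Lemma eq_path_subgraph p q : uniq p -> uniq q -> 1 < size p ->
  path_subgraph p = path_subgraph q -> q = p \/ q = rev p.
Proof.
move=> Up Uq sp; rewrite !path_subgraphE => -[_ /setP E].
by apply: eq_edges => // e; have := E e; rewrite !inE.
Qed.

Lemma rotate_path_subgraph k p :
  rotate_graph k (path_subgraph p) = path_subgraph (map (rotv k) p).
Proof.
rewrite /rotate_graph !path_subgraphE /=; congr pair.
  apply/setP=> x; rewrite inE; apply/imsetP/mapP => -[y].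
    by rewrite inE => yp ->; exists y.
  by move=> yp ->; exists y; rewrite ?inE.
have -> : edges (map (rotv k) p) =
    [seq rotv k @: (e : {set 'I_n}) | e <- edges p].
  elim: p => [//|x [//|y p] IH].
  by rewrite !map_cons edges_cons2 -map_cons IH /= imsetU !imset_set1.
apply/setP=> x; rewrite inE; apply/imsetP/mapP => -[y].
  by rewrite inE => yp ->; exists y.
by move=> yp ->; exists y; rewrite ?inE.
Qed.

(** Any [n] distinct vertices exhaust ['I_n], and distinct vertices are always adjacent. *)
Lemma hamiltonian_path_uniq (p : n.-tuple 'I_n) : hamiltonian_path p = uniq p.
Proof.
rewrite /hamiltonian_path; have [Up|_] := boolP (uniq p); last by rewrite andbF.
rewrite pairwise_sorted /=; last by rewrite -uniq_pairwise.
have: #|p| = #|'I_n| by rewrite (card_uniqP Up) size_tuple card_ord.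
move/subset_cardP => /(_ (subset_predT _)) E.
by apply/forallP=> x; rewrite E.
Qed.

End PathSubgraph.

(** * Paths starting at 0 and their reversal *)

(** Group laws can then replace modular arithmetic. *)
Lemma rotvE m k (x : 'I_m.+1) : rotv k x = (x + inZp k)%R.
Proof. by apply: val_inj; rewrite /= modnDmr. Qed.

Lemma rotv_inj n k : injective (@rotv n k).
Proof. by case: n => [[]//|m] x y; rewrite !rotvE => /addIr. Qed.

(* Rotating a path to start at 0 picks one sequence in each rotation class. *)
Definition based_paths m : {set m.+1.-tuple 'I_m.+1} :=
  [set p : m.+1.-tuple 'I_m.+1 | uniq p & nth ord0 p 0 == ord0].

(** The reversed path starts at the old last vertex; subtracting it moves the start back to 0. *)
Definition flip m (p : m.+1.-tuple 'I_m.+1) : m.+1.-tuple 'I_m.+1 :=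
  [tuple of map (fun x => (x - last ord0 p)%R) (rev p)].

(** Deleting the leading 0 leaves an ordering of the [m] nonzero vertices. *)
Lemma card_based_paths m : #|based_paths m| = m`!.
Proof.
have := card_uniq_tuples m (predC1 (ord0 : 'I_m.+1)).
rewrite cardC1 card_ord ffactnn => <-.
rewrite -(card_imset _ (f := fun t : m.-tuple 'I_m.+1 => [tuple of ord0 :: t]));
  last by move=> t u [] /val_inj.
apply: eq_card => t; apply/idP/imsetP => [|[u]]; rewrite !inE.
  case/tupleP: t => y t /= /andP[/andP[yt Ut] /eqP e]; rewrite e in yt *.
  exists t => //; rewrite inE Ut andbT; apply/allP=> x xt /=.
  by apply: contraNneq yt => <-.
move=> /andP[/allP A U] -> /=; rewrite U !andbT.
by apply/negP=> /A.
Qed.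

Section BasedPaths.
Variable m : nat.
Implicit Types s t : m.+1.-tuple 'I_m.+1.

Lemma nth0_map_rev (f : 'I_m.+1 -> 'I_m.+1) s :
  nth ord0 (map f (rev s)) 0 = f (last ord0 s).
Proof.
rewrite (nth_map ord0) ?size_rev ?size_tuple //.
by rewrite nth_rev size_tuple // subn1 -nth_last size_tuple.
Qed.

Lemma last_map_rev (f : 'I_m.+1 -> 'I_m.+1) s :
  last ord0 (map f (rev s)) = f (nth ord0 s 0).
Proof. by case/tupleP: s => x s; rewrite /= rev_cons map_rcons last_rcons. Qed.

Lemma flip_based s : s \in based_paths m -> flip s \in based_paths m.
Proof.
rewrite !inE => /andP[U _]; rewrite nth0_map_rev subrr eqxx andbT.
by rewrite map_inj_uniq ?rev_uniq //; apply: addIr.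
Qed.

(** Equality of subgraphs leaves a rotation and a possible reversal; the start at 0 determines the
    rotation. *)
Lemma equivE_based s t : 0 < m -> s \in based_paths m -> t \in based_paths m ->
  equivE (path_subgraph s) (path_subgraph t) = (t == s) || (t == flip s).
Proof.
move=> m_gt0; rewrite !inE => /andP[Us /eqP s0] /andP[Ut /eqP t0].
apply/equivEP/orP => [[k]|].
  rewrite rotate_path_subgraph => /esym /eq_path_subgraph[||||E].
  - by rewrite (map_inj_uniq (@rotv_inj _ _)).
  - by [].
  - by rewrite size_map size_tuple.
  - move=> E; left; apply/eqP/val_inj; rewrite /= E.
    move: t0; rewrite E (nth_map ord0) ?size_tuple // s0 rotvE => k0.
    rewrite -[RHS]map_id; apply: eq_map => x; rewrite rotvE.
    by move: k0; rewrite [X in X = _]add0r => ->; apply: addr0.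
  (* The rotated reversal starts at [last ord0 s + k], which must be 0, so the rotation subtracts
     [last ord0 s]. *)
  right; apply/eqP/val_inj; rewrite /= E -map_rev; move: t0.
  rewrite E -map_rev nth0_map_rev rotvE => /eqP; rewrite addr_eq0 => /eqP ->.
  by apply: eq_map => x; rewrite rotvE opprK.
case=> /eqP ->; first by exists ord0; rewrite rotate_graph0.
pose k : 'I_m.+1 := (- last ord0 s)%R; exists k; rewrite rotate_path_subgraph /= map_rev.
rewrite path_subgraph_rev; congr path_subgraph; apply: eq_map => x.
rewrite rotvE; exact: congr1 (esym (valZpK k)).
Qed.

(** [flip s] ends at minus the last vertex of [s], so twice that vertex is 0 modulo [m.+1]. *)
Lemma flip_fixed_last s : 0 < m -> s \in based_paths m -> flip s = s ->
  (last ord0 s).*2 = m.+1.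
Proof.
move=> m_gt0; rewrite inE => /andP[Us /eqP s0] fs.
have: last ord0 (flip s) = last ord0 s by rewrite fs.
rewrite last_map_rev s0 => /eqP; rewrite [X in X == _]add0r eq_sym -addr_eq0.
have ln0 : last ord0 s != ord0.
  by rewrite -[X in _ != X]s0 -nth_last nth_uniq ?size_tuple //= -lt0n.
set l := last _ _ in ln0 *; move=> /eqP/(congr1 val) /= /eqP.
(* Quotient 0 would make the last vertex 0, already used as the first; quotient 2 or more would make
   it at least [m.+1]. *)
rewrite -/(_ %| _) addnn => /dvdnP[[|[|c]]] E.
- by case/eqP: ln0; apply: val_inj => /=; apply/eqP; rewrite -double_eq0 E.
- by rewrite E mul1n.
have := ltn_ord l; rewrite -ltn_double E mulSn mulSn addnA addnn.
by rewrite -[X in _ < X]addn0 ltn_add2l.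
Qed.

End BasedPaths.

(** * From equivalence classes to fixed points *)

Lemma card_equivE_classes m : 0 < m ->
  2 * #|equivalence_partition (@equivE m.+1) (P m.+1)|
    = m`! + #|[set s in based_paths m | flip s == s]|.
Proof.
move=> m_gt0.
have /equivalence_relP[eqvr eqvl] := @equivE_equivalence m.+1 isT.
pose f (s : m.+1.-tuple 'I_m.+1) :=
  [set G in P m.+1 | equivE (path_subgraph s) G].
have sP (s : m.+1.-tuple 'I_m.+1) : uniq s -> path_subgraph s \in P m.+1.
  by move=> Us; apply/imsetP; exists s; rewrite // inE hamiltonian_path_uniq.
have fE (s t : m.+1.-tuple 'I_m.+1) : uniq s -> uniq t ->
    (f s == f t) = equivE (path_subgraph s) (path_subgraph t).
  move=> Us Ut; apply/eqP/idP => [/setP/(_ (path_subgraph t))|E].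
    by rewrite !inE sP // eqvr.
  apply/setP=> G; rewrite !inE; congr (_ && _).
  exact: eqvl.
have -> : equivalence_partition (@equivE m.+1) (P m.+1) = f @: based_paths m.
  apply/setP=> C; apply/imsetP/imsetP => [[G /imsetP[p]]|[s]].
    rewrite inE hamiltonian_path_uniq => Up -> ->.
    (* Rotating [p] by minus its first vertex makes it start at 0 within the same class. *)
    have [k kE] : exists k : 'I_m.+1, k = (- nth ord0 p 0)%R by eexists.
    have Us : uniq [tuple of map (rotv k) p].
      by rewrite (map_inj_uniq (@rotv_inj _ _)).
    exists [tuple of map (rotv k) p].
      rewrite inE Us /= (nth_map ord0) ?size_tuple // rotvE valZpK.
      by rewrite kE subrr eqxx.
    apply/eqP; rewrite -/(f p) fE //; apply/equivEP; exists k.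
    by rewrite rotate_path_subgraph.
  by rewrite inE => /andP[Us _] ->; exists (path_subgraph s); rewrite ?sP.
rewrite (card_imset_pairs (g := @flip m)) ?card_based_paths //.
  exact: flip_based.
move=> s t sX tX; rewrite fE ?equivE_based //.
  by move: sX; rewrite inE => /andP[].
by move: tX; rewrite inE => /andP[].
Qed.

(** * Counting the fixed paths *)

Lemma card_flip_fixed_odd m : 0 < m -> odd m.+1 ->
  #|[set s in based_paths m | flip s == s]| = 0.
Proof.
move=> m_gt0 om; apply/eqP; rewrite cards_eq0; apply/eqP/setP=> s.
rewrite !inE; apply/negP=> /andP[sX /eqP fs].
have sX' : s \in based_paths m by rewrite inE.
by move: om; rewrite -(flip_fixed_last m_gt0 sX' fs) odd_double.
Qed.

Lemma dfactS2 m : dfact m.+2 = m.+2 * dfact m.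
Proof.
(* Of the two top indices only [m.+2] has the required parity. *)
rewrite /dfact /= negbK big_mkcond big_nat_recr //= big_nat_recr //=.
rewrite negbK eqxx -big_mkcond /= mulnC; congr (_ * _).
by case: (odd m); rewrite muln1.
Qed.

(** This is the count from [card_antipode_free_tuples] for [k.+1.*2] vertices with 0 already
    placed. *)
Lemma dfact_double k : dfact k.*2 = \prod_(i < k) (k.+1.*2 - 2 * (1 + i)).
Proof.
elim: k => [|k IH]; first by rewrite big_ord0 /dfact big_geq.
rewrite doubleS dfactS2 IH big_ord_recl; congr (_ * _).
apply: eq_bigr => i _; rewrite /= /bump leq0n [in RHS]doubleS.
by rewrite [2 * (1 + (1 + i))]mulnDr muln1 subnDA subn2.
Qed.

Lemma card_flip_fixed_even k :
  #|[set s in based_paths k.*2.+1 | flip s == s]| = dfact k.*2.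
Proof.
set m := k.*2.+1.
(* [h] is the half-turn: there are [m.+1 = 2(k + 1)] vertices. *)
have [h hval] : exists h : 'I_m.+1, h = k.+1 :> nat.
  by exists (inZp k.+1); rewrite /= modn_small // /m !ltnS -addnn leq_addl.
have hh : (h + h = 0)%R.
  by apply: val_inj; rewrite /= hval addnn doubleS modnn.
have hN : (- h = h)%R by apply/eqP; rewrite eq_sym -addr_eq0 hh.
pose sigma (x : 'I_m.+1) := (x + h)%R.
have sigmaK : involutive sigma by move=> x; rewrite /sigma -addrA hh addr0.
have sigma_neq x : sigma x != x.
  rewrite /sigma -subr_eq0 addrAC subrr add0r; apply/eqP=> /(congr1 (@nat_of_ord _)).
  by rewrite hval.
(* The first half, 0 followed by the [k] choices in [t], then its antipodes in reverse order. *)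
pose w (t : seq 'I_m.+1) := (ord0 :: t) ++ map sigma (rev (ord0 :: t)).
have sizew (t : k.-tuple 'I_m.+1) : size (w t) == m.+1.
  by rewrite size_cat size_map size_rev /= size_tuple addnn doubleS.
pose phi t := Tuple (sizew t).
have free_w t : antipode_free sigma (catrev t [:: ord0]) = uniq (w t).
  rewrite catrevE cats1 -rev_cons; apply: perm_uniq.
  by rewrite perm_cat2r perm_rev.
have free1 : antipode_free sigma [:: ord0].
  by rewrite /antipode_free /= inE eq_sym sigma_neq.
rewrite dfact_double -[k.+1.*2]card_ord.
rewrite -(card_antipode_free_tuples sigmaK sigma_neq k free1).
rewrite -(card_imset _ (f := phi)); last first.
  move=> t u /(congr1 val)/eqP; rewrite /= eqseq_cons eqxx eqseq_cat ?size_tuple //.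
  by case/and3P=> _ /eqP e _; apply: val_inj.
apply: eq_card => s; apply/idP/imsetP => [|[t]]; last first.
  rewrite inE free_w => uniq_w -> {s}.
  rewrite !inE; apply/andP; split; first by rewrite [uniq _]uniq_w.
  apply/eqP/val_inj.
  change ([seq (x - last ord0 (w t))%R | x <- rev (w t)] = w t).
  have -> : last ord0 (w t) = h.
    by rewrite /w rev_cons map_rcons last_cat last_rcons /sigma add0r.
  rewrite /w rev_cat -map_rev revK map_cat -map_comp hN.
  by congr (_ ++ _); rewrite -[RHS]map_id; apply: eq_map => x; apply: sigmaK.
rewrite inE => /andP[sX /eqP fs].
have lh : last ord0 s = h.
  apply/val_inj/double_inj; rewrite (flip_fixed_last _ sX fs) //.
  by rewrite -[RHS]/((h : nat).*2) hval.
(* Subtracting the last vertex [h] is [sigma], because [- h = h]. *)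
have sE : s = map sigma (rev s) :> seq _.
  by rewrite -{1}fs /= lh hN.
move: sX; rewrite inE => /andP[Us /eqP s0].
have szt : size (behead (take k.+1 s)) == k.
  by rewrite size_behead size_take size_tuple /m !ltnS -addnn leq_addl.
have tkE : take k.+1 s = ord0 :: behead (take k.+1 s).
  by case/tupleP: (s) s0 => x u /= ->.
(* Comparing second halves in [sE]: the last [k.+1] entries are the antipodes of the first [k.+1],
   reversed. *)
have sw : s = w (behead (take k.+1 s)) :> seq _.
  have := sE; rewrite -{1 2}(cat_take_drop k.+1 s) rev_cat map_cat => /eqP.
  rewrite eqseq_cat => [/andP[_ /eqP dE]|].
    by rewrite -{1}(cat_take_drop k.+1 s) dE /w -tkE.
  rewrite size_map size_rev size_drop size_take size_tuple /m !ltnS -addnn.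
  by rewrite leq_addl -addnS -addSn addnK.
exists (Tuple szt); last exact: val_inj.
by rewrite inE free_w -[tval _]/(behead (take k.+1 s)) -sw.
Qed.

(** * Assembling the formula over the rationals *)

Local Open Scope ring_scope.

Theorem theorem7 (n : nat) (hn : (3 <= n)%N) :
  #|equivalence_partition (@equivE n) (P n)|%:R =
    1 / 2 * (((n - 1)`!)%:R + (if ~~ odd n then (dfact (n - 2))%:R else 0))
    :> rat.
Proof.
case: n hn => [//|m] hn; have m_gt0 : (0 < m)%N by exact: ltnW.
have fixed : #|[set s in based_paths m | flip s == s]| =
    (if ~~ odd m.+1 then dfact (m.+1 - 2) else 0)%N.
  case: ifPn => [om|/negPn om]; last exact: card_flip_fixed_odd.
  (* As [m.+1] is even, [m = 2k + 1] with [k = m.-1./2]. *)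
  have -> : m = m.-1./2.*2.+1.
    case: (m) m_gt0 om => //= j _; rewrite !negbK => oj.
    by rewrite -[LHS](odd_double_half j.+1) /= oj uphalf_half (negPf oj).
  by rewrite card_flip_fixed_even subSS subn1.
(* Doubling both sides clears the factor 1/2. *)
apply: (mulfI (x := 2%:R)) => //.
rewrite -natrM card_equivE_classes // fixed subn1 natrD mulrA.
by rewrite mul1r mulfV // mul1r; case: ifP.
Qed.
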